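(* Let $M_1,M_2,M_3$ be microlinear spaces with $x_1\in M_1$, $x_2\in M_2$, $x_3\in M_3$. If $\xi_1$ is a Dirac $x_1$-flow on $M_1$, $\xi_2$ is a Dirac $x_2$-flow on $M_2$ and $\xi_3$ is a Dirac $x_3$-flow on $M_3$, then, after identifying $M_2\times M_3\times M_1$ and $M_3\times M_1\times M_2$ with $M_1\times M_2\times M_3$ in the natural way, $$\lfloor \xi_1,\lfloor \xi_2,\xi_3\rfloor\rfloor+\lfloor \xi_2,\lfloor \xi_3,\xi_1\rfloor\rfloor+\lfloor \xi_3,\lfloor \xi_1,\xi_2\rfloor\rfloor=0 ,$$ where sum and zero are those of tangent vectors to $[[M_1\times M_2\times M_3\to\mathbb{R}]\to\mathbb{R}]$ at $\delta_{(x_1,x_2,x_3)}$.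
   Context: Setting: synthetic differential geometry, i.e. (intuitionistic) reasoning inside a cartesian closed universe of spaces, as in Lavendhomme's ''Basic Concepts of Synthetic Differential Geometry''. $[X\to Y]$ is the exponential $Y^X$. $\mathbb{R}$ is the line, a commutative ring satisfying the generalized Kock–Lawvere axiom (for each Weil algebra $W$ the canonical map $W\to[\mathrm{Spec}_{\mathbb R}W\to\mathbb{R}]$ is bijective). $D=\{d\in\mathbb{R}: d^2=0\}$, $D(2)=\{(d_1,d_2)\in D^2: d_1d_2=0\}$. A space $X$ is microlinear if every finite diagram of infinitesimal objects $\mathrm{Spec}_{\mathbb R}W$ with cocone which $[-\to\mathbb{R}]$ turns into a limit diagram is also turned into a limit diagram by $[-\to X]$. $\mathbb{R}$ is microlinear, and if $X$ is microlinear, so is $[Y\to X]$ for every space $Y$. Tangent vectors: a tangent vector to a microlinear $X$ at $x$ is $t:D\to X$ with $t(0)=x$. Those at $x$ form an $\mathbb{R}$-module: $(\alpha t)(d)=t(\alpha d)$ and $(t_1+t_2)(d)=l(d,d)$, where $l:D(2)\to X$ is the unique map with $l(d,0)=t_1(d)$, $l(0,d)=t_2(d)$; zero is the constant map. Strong difference: for $\gamma_1,\gamma_2:D^2\to X$ ($X$ microlinear) with $\gamma_1|_{D(2)}=\gamma_2|_{D(2)}$, there is a unique $k:\{(d_1,d_2,e)\in D^3: d_1e=d_2e=0\}\to X$ with $k(d_1,d_2,0)=\gamma_2(d_1,d_2)$ and $k(d_1,d_2,d_1d_2)=\gamma_1(d_1,d_2)$; put $(\gamma_1\overset{\cdot}{-}\gamma_2)(e)=k(0,0,e)$.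 Convolutions: for $f\in[[A\to\mathbb{R}]\to\mathbb{R}]$, $g\in[[B\to\mathbb{R}]\to\mathbb{R}]$, define $f\ast g,\ f\,\widetilde{\ast}\,g\in[[A\times B\to\mathbb{R}]\to\mathbb{R}]$ by $(f\ast g)(h)=f(\lambda a.\,g(\lambda b.\,h(a,b)))$ and $(f\,\widetilde{\ast}\,g)(h)=g(\lambda b.\,f(\lambda a.\,h(a,b)))$. For $a\in A$, $\delta_a(f)=f(a)$. A distribution with compact support on $M$ is a map $u:[M\to\mathbb{R}]\to\mathbb{R}$ with $u(\alpha f)=\alpha u(f)$ for all $f\in[M\to\mathbb{R}]$, $\alpha\in\mathbb{R}$. For $x\in M$, a Dirac $x$-flow on $M$ is a map $\xi:D\to[[M\to\mathbb{R}]\to\mathbb{R}]$ with $\xi(0)=\delta_x$ such that $\xi(d)$ is a distribution with compact support on $M$ for every $d\in D$. Bracket: for maps $\xi_1:D\to[[A\to\mathbb{R}]\to\mathbb{R}]$ and $\xi_2:D\to[[B\to\mathbb{R}]\to\mathbb{R}]$ with $\xi_1(0)=\delta_{a_0}$, $\xi_2(0)=\delta_{b_0}$, put $(\xi_1\circledast\xi_2)(d_1,d_2)=\xi_1(d_1)\ast\xi_2(d_2)$ and $(\xi_1\widetilde{\circledast}\xi_2)(d_1,d_2)=\xi_1(d_1)\,\widetilde{\ast}\,\xi_2(d_2)$; these agree on $D(2)$, and $\lfloor\xi_1,\xi_2\rfloor=\xi_1\widetilde{\circledast}\xi_2\overset{\cdot}{-}\xi_1\circledast\xi_2:D\to[[A\times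 B\to\mathbb{R}]\to\mathbb{R}]$, with $\lfloor\xi_1,\xi_2\rfloor(0)=\delta_{(a_0,b_0)}$. Identification: $\varphi\in[[M_2\times M_3\times M_1\to\mathbb{R}]\to\mathbb{R}]$ is regarded as an element of $[[M_1\times M_2\times M_3\to\mathbb{R}]\to\mathbb{R}]$ by $h\mapsto\varphi(\lambda(b,c,a).\,h(a,b,c))$, and similarly for $M_3\times M_1\times M_2$. *)

(* Defs.v *)
From Stdlib Require Import Ring List FinFun FunctionalExtensionality ProofIrrelevance.
Import ListNotations.

(** Synthetic differential geometry with the types of Rocq as the cartesian
    closed universe of spaces: [X -> Y] is the exponential and a subspace is a
    [sig] type.  Nothing here may presuppose classical logic or decidable
    equality on the line, either of which would force the line to be trivial;
    for this reason rings are taken in the sense of [ring_theory], over a bare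
    type.  Function extensionality and proof irrelevance are used; "bijective"
    and "limit" carry the (unique) inverse as data, so that objects
    characterised by unique existence can be named without a choice principle. *)

Set Implicit Arguments.

Record bijection (A B : Type) (f : A -> B) : Type := Bijection {
  inv : B -> A;
  inv_l : forall a, inv (f a) = a;
  inv_r : forall b, f (inv b) = b }.

Definition bij_sym A B (f : A -> B) (b : bijection f) : bijection (inv b) :=
  Bijection (inv b) f (inv_r b) (inv_l b).

Lemma bij_inj A B (f : A -> B) : bijection f -> forall x y, f x = f y -> x = y.
Proof. intros b x y e. rewrite <- (inv_l b x), e. apply inv_l. Qed.

Definition bij_intro A B (f : A -> B) (g : B -> A)
    (gr : forall b, f (g b) = b) (fi : forall x y, f x = f y -> x = y) :
  bijection f :=
  Bijection f g (fun a => fi _ _ (gr (f a))) gr.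

Lemma sig_ext (A : Type) (P : A -> Prop) (x y : sig P) :
  proj1_sig x = proj1_sig y -> x = y.
Proof. apply eq_sig_hprop. intros; apply proof_irrelevance. Qed.

Record comRing : Type := ComRing {
  car :> Type;
  zero : car;
  one : car;
  add : car -> car -> car;
  mul : car -> car -> car;
  opp : car -> car;
  comRing_theory :
    ring_theory zero one add mul (fun x y => add x (opp y)) opp (@eq car) }.

Arguments zero {c}.
Arguments one {c}.

Declare Scope line_scope.
Delimit Scope line_scope with line.
Notation "0" := zero : line_scope.
Notation "1" := one : line_scope.
Infix "+" := (add _) : line_scope.
Infix "*" := (mul _) : line_scope.
Notation "- x" := (opp _ x) : line_scope.
Local Open Scope line_scope.

Record ring_hom (A B : comRing) (f : A -> B) : Prop := RingHom {
  hom_one : f 1 = 1;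
  hom_add : forall x y, f (x + y) = f x + f y;
  hom_mul : forall x y, f (x * y) = f x * f y }.

Section Line.

Variable R : comRing.

Add Ring R_ring : (comRing_theory R).

Fixpoint pow (n : nat) : Type :=
  match n with O => unit | S m => (R * pow m)%type end.

Fixpoint padd (n : nat) : pow n -> pow n -> pow n :=
  match n with
  | O => fun _ _ => tt
  | S m => fun v w => (fst v + fst w, padd m (snd v) (snd w))
  end.

Fixpoint pscale (n : nat) (r : R) : pow n -> pow n :=
  match n with
  | O => fun _ => tt
  | S m => fun v => (r * fst v, pscale m r (snd v))
  end.

(** An augmented commutative [R]-algebra, free of finite rank as a module,
    with nilpotent augmentation ideal. *)
Record weil : Type := Weil {
  walg :> comRing;
  wincl : R -> walg;
  wincl_hom : ring_hom R walg wincl;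
  waug : walg -> R;
  waug_hom : ring_hom walg R waug;
  waug_incl : forall r, waug (wincl r) = r;
  wdim : nat;
  wcoord : walg -> pow wdim;
  wcoord_bij : bijection wcoord;
  wcoord_add : forall v w, wcoord (v + w) = padd wdim (wcoord v) (wcoord w);
  wcoord_scale : forall r w, wcoord (wincl r * w) = pscale wdim r (wcoord w);
  wnilpotent : exists N, forall l : list walg,
    length l = N -> Forall (fun w => waug w = 0) l ->
    fold_right (mul walg) 1 l = 0 }.

Record Spec (W : weil) : Type := MkSpec {
  ev :> W -> R;
  ev_hom : ring_hom W R ev;
  ev_incl : forall r, ev (wincl W r) = r }.

Lemma Spec_ext (W : weil) (p q : Spec W) : (forall w, p w = q w) -> p = q.
Proof.
destruct p as [p hp ip], q as [q hq iq]; cbn; intros e.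
assert (p = q) by (apply functional_extensionality, e); subst q.
f_equal; apply proof_irrelevance.
Qed.

Definition KockLawvere : Type :=
  forall W : weil, bijection (fun (w : W) (p : Spec W) => p w).

Record graph : Type := Graph {
  vert : Type;
  edge : Type;
  src : edge -> vert;
  tgt : edge -> vert }.

(** A diagram of spaces together with a cocone under it.  The shape is a graph
    rather than a category: the composition law of the shape is irrelevant for
    the compatibility conditions. *)
Record cocone (G : graph) : Type := Cocone {
  obj : vert G -> Type;
  arr : forall e, obj (src G e) -> obj (tgt G e);
  apex : Type;
  leg : forall v, obj v -> apex;
  leg_arr : forall e (x : obj (src G e)), leg (arr e x) = leg x }.

Arguments leg [G] _ _ _.

Record matching (G : graph) (K : cocone G) (X : Type) : Type := Matching {
  leg_map : forall v, obj K v -> X;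
  leg_map_arr : forall e (x : obj K (src G e)),
    leg_map _ (arr K e x) = leg_map _ x }.

Arguments leg_map [G K X] _ _ _.
Arguments Matching [G] K [X] _ _.

Definition restrict (G : graph) (K : cocone G) (X : Type) (f : apex K -> X) :
  matching K X :=
  Matching K (fun v x => f (leg K v x)) (fun e x => f_equal f (leg_arr K e x)).

(** [[- -> X]] turns the cocone into a limit cone: the canonical map to the
    standard limit, the space of matching families, is bijective. *)
Definition limiting (G : graph) (K : cocone G) (X : Type) : Type :=
  bijection (@restrict G K X).

Definition finite (T : Type) : Prop := exists l : list T, Listing l.

Definition microlinear (X : Type) : Type :=
  forall (G : graph), finite (vert G) -> finite (edge G) ->
  forall (W : vert G -> weil)
    (a : forall e, Spec (W (src G e)) -> Spec (W (tgt G e)))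
    (P : weil) (l : forall v, Spec (W v) -> Spec P)
    (la : forall e x, l (tgt G e) (a e x) = l (src G e) x),
  let K := Cocone G (fun v => Spec (W v)) a l la in
  limiting K R -> limiting K X.

Lemma microlinear_line : microlinear R.
Proof. intros G fv fe W a P l la K HK; exact HK. Qed.

Lemma matching_ext (G : graph) (K : cocone G) X (s t : matching K X) :
  (forall v x, leg_map s v x = leg_map t v x) -> s = t.
Proof.
destruct s as [s hs], t as [t ht]; cbn; intros e.
assert (s = t).
{ apply functional_extensionality_dep; intros v.
  apply functional_extensionality; intros x; apply e. }
subst t; f_equal; apply proof_irrelevance.
Qed.

Lemma limiting_exp (G : graph) (K : cocone G) (X Y : Type) :
  limiting K X -> limiting K (Y -> X).
Proof.
intros H.
pose (at_ y (s : matching K (Y -> X)) := Matching K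
  (fun v x => leg_map s v x y)
  (fun e x => f_equal (fun h => h y) (leg_map_arr s e x))).
exists (fun s p y => inv H (at_ y s) p).
- intros f; apply functional_extensionality; intros p.
  apply functional_extensionality; intros y.
  transitivity (inv H (restrict K (fun q => f q y)) p).
  + f_equal; f_equal; apply matching_ext; reflexivity.
  + now rewrite inv_l.
- intros s; apply matching_ext; intros v x.
  apply functional_extensionality; intros y; cbn.
  change (leg_map (restrict K (inv H (at_ y s))) v x = leg_map s v x y).
  now rewrite inv_r.
Qed.

Lemma microlinear_exp (X Y : Type) : microlinear X -> microlinear (Y -> X).
Proof.
intros m G fv fe W a P l la K HK; apply limiting_exp, m; assumption.
Qed.

(** Invariance under isomorphism, so that concrete spaces such as [D] can stand
    for the corresponding spectra. *)

Lemma limiting_iso (G : graph) (K L : cocone G) (X : Type)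
    (o : forall v, obj K v -> obj L v) (ob : forall v, bijection (o v))
    (c : apex K -> apex L) (cb : bijection c)
    (oa : forall e x, o _ (arr K e x) = arr L e (o _ x))
    (cl : forall v x, c (leg K v x) = leg L v (o v x)) :
  limiting K X -> limiting L X.
Proof.
intros H.
assert (pull_ok : forall s : matching L X,
  forall e x, leg_map s _ (o _ (arr K e x)) = leg_map s _ (o _ x)).
{ intros [s hs] e x; cbn; rewrite oa; apply hs. }
pose (pull (s : matching L X) := Matching K
  (fun v x => leg_map s v (o v x)) (pull_ok s)).
exists (fun s p => inv H (pull s) (inv cb p)).
- intros f; apply functional_extensionality; intros p.
  transitivity (inv H (restrict K (fun q => f (c q))) (inv cb p)).
  + f_equal; f_equal; apply matching_ext; intros v x; cbn; now rewrite cl.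
  + now rewrite inv_l, inv_r.
- intros s; apply matching_ext; intros v y; cbn.
  rewrite <- (inv_r (ob v) y), <- cl, inv_l.
  change (leg_map (restrict K (inv H (pull s))) v (inv (ob v) y)
          = leg_map s v (o v (inv (ob v) y))).
  now rewrite inv_r.
Qed.

Definition infinitesimal (E : Type) : Type :=
  {W : weil & {o : E -> Spec W & bijection o}}.

Lemma microlinear_limiting (X : Type) (m : microlinear X)
    (G : graph) (fv : finite (vert G)) (fe : finite (edge G)) (K : cocone G)
    (io : forall v, infinitesimal (obj K v)) (ia : infinitesimal (apex K)) :
  limiting K R -> limiting K X.
Proof.
intros H; destruct ia as [P [c cb]].
pose (W v := projT1 (io v)).
pose (o v := projT1 (projT2 (io v)) : obj K v -> Spec (W v)).
pose (ob v := projT2 (projT2 (io v)) : bijection (o v)).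
pose (a e x := o _ (arr K e (inv (ob _) x))).
pose (l v x := c (leg K v (inv (ob v) x))).
assert (la : forall e x, l _ (a e x) = l _ x).
{ intros e x; unfold l, a; now rewrite inv_l, leg_arr. }
pose (L := Cocone G (fun v => Spec (W v)) a l la).
assert (limiting L X) as HX.
{ apply m; trivial.
  apply (limiting_iso (K := K) L o ob cb); trivial; intros; cbn; unfold a, l;
    now rewrite inv_l. }
apply (limiting_iso (K := L) K (fun v => inv (ob v))
  (fun v => bij_sym (ob v)) (bij_sym cb)); trivial.
- intros e x; cbn; unfold a; now rewrite inv_l.
- intros v x; cbn; unfold l; now rewrite inv_l.
Qed.

Definition D : Type := {d : R | d * d = 0}.
Definition D2 : Type := {p : D * D | proj1_sig (fst p) * proj1_sig (snd p) = 0}.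
(** [(d1, d2, e)] with [d1 e = d2 e = 0]. *)
Definition DDvD : Type :=
  {q : D * D * D | proj1_sig (fst (fst q)) * proj1_sig (snd q) = 0 /\
                   proj1_sig (snd (fst q)) * proj1_sig (snd q) = 0}.

Definition D0 : D.
Proof. exists 0; abstract ring. Defined.

Lemma mul_D (d e : D) : (proj1_sig d * proj1_sig e) * (proj1_sig d * proj1_sig e) = 0.
Proof.
transitivity ((proj1_sig d * proj1_sig d) * (proj1_sig e * proj1_sig e)); [ring|].
rewrite (proj2_sig d); ring.
Qed.

Definition Dmul (d e : D) : D := exist _ (proj1_sig d * proj1_sig e) (mul_D d e).

Definition D2_l (d : D) : D2.
Proof. exists (d, D0); abstract (cbn; ring). Defined.
Definition D2_r (d : D) : D2.
Proof. exists (D0, d); abstract (cbn; ring). Defined.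
Definition D2_diag (d : D) : D2 :=
  exist (fun p : D * D => _) (d, d) (proj2_sig d).

Definition DDvD_base (p : D * D) : DDvD.
Proof. exists (p, D0); abstract (cbn; split; ring). Defined.

Definition DDvD_prod (p : D * D) : DDvD.
Proof.
exists (p, Dmul (fst p) (snd p)).
abstract (destruct p as [[d hd] [e he]]; cbn; split;
  [transitivity ((d * d) * e); [ring | rewrite hd; ring]
  |transitivity (d * (e * e)); [ring | rewrite he; ring]]).
Defined.

Definition DDvD_top (d : D) : DDvD.
Proof. exists (D0, D0, d); abstract (cbn; split; ring). Defined.

(** The Weil algebras below have carrier [pow n], in the monomial bases [1];
    [1, x]; [1, x, y] with [xy = 0]; [1, x, y, xy]; and [1, x, y, xy, z] with
    [xz = yz = 0]; every square of a variable vanishes. *)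

Ltac pow_cases :=
  repeat match goal with
  | v : pow _ |- _ => progress cbn in v
  | v : car _ |- _ => progress cbn in v
  | v : (_ * _)%type |- _ => destruct v
  | v : unit |- _ => destruct v
  end.
Ltac coord_ring :=
  repeat match goal with |- (_, _) = (_, _) => apply f_equal2 end;
  solve [reflexivity | ring].
Ltac by_coord := intros; pow_cases; cbn; coord_ring.

Fixpoint popp (n : nat) : pow n -> pow n :=
  match n with
  | O => fun _ => tt
  | S m => fun v => (- fst v, popp m (snd v))
  end.

Fixpoint pzero (n : nat) : pow n :=
  match n with O => tt | S m => (0, pzero m) end.

Definition pone (n : nat) : pow (S n) := (1, pzero n).

Definition powRing (n : nat) (m : pow (S n) -> pow (S n) -> pow (S n)) th :
  comRing :=
  @ComRing (pow (S n)) (pzero (S n)) (pone n) (padd (S n)) m (popp (S n)) th.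

Definition mul1 (v w : pow 1) : pow 1 :=
  let '(a, _) := v in let '(a', _) := w in (a * a', tt).

Definition mulD (v w : pow 2) : pow 2 :=
  let '(a, (b, _)) := v in let '(a', (b', _)) := w in
  (a * a', (a * b' + b * a', tt)).

Definition mulD2 (v w : pow 3) : pow 3 :=
  let '(a, (b, (c, _))) := v in let '(a', (b', (c', _))) := w in
  (a * a', (a * b' + b * a', (a * c' + c * a', tt))).

Definition mulDD (v w : pow 4) : pow 4 :=
  let '(a, (b, (c, (m, _)))) := v in let '(a', (b', (c', (m', _)))) := w in
  (a * a', (a * b' + b * a', (a * c' + c * a',
  (a * m' + m * a' + b * c' + c * b', tt)))).

Definition mulDDvD (v w : pow 5) : pow 5 :=
  let '(a, (b, (c, (m, (n, _))))) := v in
  let '(a', (b', (c', (m', (n', _))))) := w in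
  (a * a', (a * b' + b * a', (a * c' + c * a',
  (a * m' + m * a' + b * c' + c * b', (a * n' + n * a', tt))))).

Definition ring1 : comRing.
Proof. refine (@powRing 0 mul1 _); abstract (constructor; by_coord). Defined.
Definition ringD : comRing.
Proof. refine (@powRing 1 mulD _); abstract (constructor; by_coord). Defined.
Definition ringD2 : comRing.
Proof. refine (@powRing 2 mulD2 _); abstract (constructor; by_coord). Defined.
Definition ringDD : comRing.
Proof. refine (@powRing 3 mulDD _); abstract (constructor; by_coord). Defined.
Definition ringDDvD : comRing.
Proof. refine (@powRing 4 mulDDvD _); abstract (constructor; by_coord). Defined.

Ltac solve_nil :=
  exists 3; intros l hl hF;
  destruct l as [|u [|v [|w [|? ?]]]]; try discriminate hl;
  inversion_clear hF as [|? ? hu hF1]; inversion_clear hF1 as [|? ? hv hF2];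
  inversion_clear hF2 as [|? ? hw _];
  cbn in u, v, w; pow_cases; cbn in hu, hv, hw |- *;
  subst; coord_ring.

Definition wpow n (A : comRing) (incl : R -> A) (aug : A -> R)
  (c : A -> pow n) cb hi ha hai hca hcs hn : weil :=
  @Weil A incl hi aug ha hai n c cb hca hcs hn.

Definition id_bij (A : Type) : bijection (fun x : A => x) :=
  Bijection (fun x : A => x) (fun x => x) (fun x => eq_refl) (fun x => eq_refl).

Definition weil1 : weil.
Proof.
refine (@wpow 1 ring1 (fun r => (r, pzero 0)) fst (fun v => v) (id_bij _) _ _ _ _ _ _);
abstract (solve [constructor; by_coord | by_coord | solve_nil]).
Defined.
Definition weilD : weil.
Proof.
refine (@wpow 2 ringD (fun r => (r, pzero 1)) fst (fun v => v) (id_bij _) _ _ _ _ _ _);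
abstract (solve [constructor; by_coord | by_coord | solve_nil]).
Defined.
Definition weilD2 : weil.
Proof.
refine (@wpow 3 ringD2 (fun r => (r, pzero 2)) fst (fun v => v) (id_bij _) _ _ _ _ _ _);
abstract (solve [constructor; by_coord | by_coord | solve_nil]).
Defined.
Definition weilDD : weil.
Proof.
refine (@wpow 4 ringDD (fun r => (r, pzero 3)) fst (fun v => v) (id_bij _) _ _ _ _ _ _);
abstract (solve [constructor; by_coord | by_coord | solve_nil]).
Defined.
Definition weilDDvD : weil.
Proof.
refine (@wpow 5 ringDDvD (fun r => (r, pzero 4)) fst (fun v => v) (id_bij _) _ _ _ _ _ _);
abstract (solve [constructor; by_coord | by_coord | solve_nil]).
Defined.

Definition polD (w : pow 2) (d : D) : R :=
  let '(a, (b, _)) := w in a + b * proj1_sig d.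

Definition polD2 (w : pow 3) (p : D2) : R :=
  let '(a, (b, (c, _))) := w in
  a + b * proj1_sig (fst (proj1_sig p)) + c * proj1_sig (snd (proj1_sig p)).

Definition polDD (w : pow 4) (p : D * D) : R :=
  let '(a, (b, (c, (m, _)))) := w in
  a + b * proj1_sig (fst p) + c * proj1_sig (snd p)
    + m * (proj1_sig (fst p) * proj1_sig (snd p)).

Definition polDDvD (w : pow 5) (q : DDvD) : R :=
  let '(a, (b, (c, (m, (n, _))))) := w in
  let d1 := proj1_sig (fst (fst (proj1_sig q))) in
  let d2 := proj1_sig (snd (fst (proj1_sig q))) in
  a + b * d1 + c * d2 + m * (d1 * d2) + n * proj1_sig (snd (proj1_sig q)).

Lemma add_null (x y z : R) : z = 0 -> y = x + z -> x = y.
Proof. intros -> ->; ring. Qed.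

Lemma mul_null_r (x y : R) : y = 0 -> x * y = 0.
Proof. intros ->; ring. Qed.

Lemma add_null2 (x y : R) : x = 0 -> y = 0 -> x + y = 0.
Proof. intros -> ->; ring. Qed.

Ltac null := repeat first [apply add_null2 | assumption | apply mul_null_r].

Definition ev1 (u : unit) : Spec weil1.
Proof.
exists (fun w : pow 1 => fst w);
  [abstract (split; intros; pow_cases; reflexivity) | reflexivity].
Defined.

Definition evD (d : D) : Spec weilD.
Proof.
exists (fun w => polD w d).
- abstract (destruct d as [d h]; split;
    [cbn; ring
    |intros [a [b []]] [a' [b' []]]; cbn; ring
    |intros [a [b []]] [a' [b' []]]; cbn;
     apply (@add_null _ _ (b * b' * (d * d))); [null | ring]]).
- abstract (intros r; cbn; ring).
Defined.

Definition evD2 (p : D2) : Spec weilD2.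
Proof.
exists (fun w => polD2 w p).
- abstract (destruct p as [[[d h] [e k]] z]; cbn in z; split;
    [cbn; ring
    |intros [a [b [c []]]] [a' [b' [c' []]]]; cbn; ring
    |intros [a [b [c []]]] [a' [b' [c' []]]]; cbn;
     apply (@add_null _ _ (b * b' * (d * d) + c * c' * (e * e)
       + (b * c' + b' * c) * (d * e))); [null | ring]]).
- abstract (intros r; cbn; ring).
Defined.

Definition evDD (p : D * D) : Spec weilDD.
Proof.
exists (fun w => polDD w p).
- abstract (destruct p as [[d h] [e k]]; split;
    [cbn; ring
    |intros [a [b [c [m []]]]] [a' [b' [c' [m' []]]]]; cbn; ring
    |intros [a [b [c [m []]]]] [a' [b' [c' [m' []]]]]; cbn;
     apply (@add_null _ _
       ((b * b' + (b * m' + b' * m) * e + m * m' * (e * e)) * (d * d)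
        + (c * c' + (c * m' + c' * m) * d) * (e * e))); [null | ring]]).
- abstract (intros r; cbn; ring).
Defined.

Definition evDDvD (q : DDvD) : Spec weilDDvD.
Proof.
exists (fun w => polDDvD w q).
- abstract (destruct q as [[[[d h] [e k]] [f l]] [z1 z2]]; cbn in z1, z2; split;
    [cbn; ring
    |intros [a [b [c [m [n []]]]]] [a' [b' [c' [m' [n' []]]]]]; cbn; ring
    |intros [a [b [c [m [n []]]]]] [a' [b' [c' [m' [n' []]]]]]; cbn;
     apply (@add_null _ _
       ((b * b' + (b * m' + b' * m) * e + m * m' * (e * e)) * (d * d)
        + (c * c' + (c * m' + c' * m) * d) * (e * e) + n * n' * (f * f)
        + (b * n' + b' * n + (m * n' + m' * n) * e) * (d * f)
        + (c * n' + c' * n) * (e * f))); [null | ring]]).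
- abstract (intros r; cbn; ring).
Defined.

Lemma ev_null (W : weil) (p : Spec W) (v w : W) : v * w = wincl W 0 -> p v * p w = 0.
Proof.
intros e; rewrite <- (hom_mul (ev_hom p)), e; apply ev_incl.
Qed.

Lemma ev1_bij : bijection ev1.
Proof.
apply (bij_intro _ (fun _ => tt)); [|now intros [] []].
intros p; apply Spec_ext; intros [a []]; symmetry; apply (ev_incl p a).
Qed.

Lemma spec_mul (W : weil) (p : Spec W) r w : p (wincl W r * w) = r * p w.
Proof. now rewrite (hom_mul (ev_hom p)), (ev_incl p). Qed.

Lemma evD_bij : bijection evD.
Proof.
unshelve refine (bij_intro _ (fun p => _) _ _).
- exists (p ((0, (1, tt)) : pow 2)); apply ev_null; by_coord.
- intros p; apply Spec_ext; intros [a [b []]]; cbn.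
  rewrite <- (ev_incl p a) at 1; rewrite <- !spec_mul, <- !(hom_add (ev_hom p)).
  f_equal; by_coord.
- intros x y e; apply sig_ext.
  generalize (f_equal (fun p : Spec weilD => p ((0, (1, tt)) : pow 2)) e); cbn.
  intros h; ring_simplify in h; exact h.
Qed.

Lemma evD2_bij : bijection evD2.
Proof.
unshelve refine (bij_intro _ (fun p => _) _ _).
- unshelve eexists.
  + split; [exists (p ((0, (1, (0, tt))) : pow 3))
           |exists (p ((0, (0, (1, tt))) : pow 3))];
    apply ev_null; by_coord.
  + cbn; apply ev_null; by_coord.
- intros p; apply Spec_ext; intros [a [b [c []]]]; cbn.
  rewrite <- (ev_incl p a) at 1; rewrite <- !spec_mul, <- !(hom_add (ev_hom p)).
  f_equal; by_coord.
- intros [[x y] z] [[x' y'] z'] e; apply sig_ext; cbn.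
  generalize (f_equal (fun p : Spec weilD2 => p ((0, (1, (0, tt))) : pow 3)) e);
  generalize (f_equal (fun p : Spec weilD2 => p ((0, (0, (1, tt))) : pow 3)) e);
  cbn; intros h k; ring_simplify in h; ring_simplify in k.
  f_equal; apply sig_ext; assumption.
Qed.

Lemma evDD_bij : bijection evDD.
Proof.
unshelve refine (bij_intro _ (fun p => _) _ _).
- split; [exists (p ((0, (1, (0, (0, tt)))) : pow 4))
         |exists (p ((0, (0, (1, (0, tt)))) : pow 4))];
    apply ev_null; by_coord.
- intros p; apply Spec_ext; intros [a [b [c [m []]]]]; cbn.
  rewrite <- (hom_mul (ev_hom p)).
  rewrite <- (ev_incl p a) at 1; rewrite <- !spec_mul, <- !(hom_add (ev_hom p)).
  f_equal; by_coord.
- intros [x y] [x' y'] e; cbn.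
  generalize (f_equal (fun p : Spec weilDD => p ((0, (1, (0, (0, tt)))) : pow 4)) e);
  generalize (f_equal (fun p : Spec weilDD => p ((0, (0, (1, (0, tt)))) : pow 4)) e);
  cbn; intros h k; ring_simplify in h; ring_simplify in k.
  f_equal; apply sig_ext; assumption.
Qed.

Lemma evDDvD_bij : bijection evDDvD.
Proof.
unshelve refine (bij_intro _ (fun p => _) _ _).
- unshelve eexists.
  + split; [split;
     [exists (p ((0, (1, (0, (0, (0, tt))))) : pow 5))
     |exists (p ((0, (0, (1, (0, (0, tt))))) : pow 5))]
     |exists (p ((0, (0, (0, (0, (1, tt))))) : pow 5))];
    apply ev_null; by_coord.
  + cbn; split; apply ev_null; by_coord.
- intros p; apply Spec_ext; intros [a [b [c [m [n []]]]]]; cbn.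
  rewrite <- (hom_mul (ev_hom p)).
  rewrite <- (ev_incl p a) at 1; rewrite <- !spec_mul, <- !(hom_add (ev_hom p)).
  f_equal; by_coord.
- intros [[[x y] f] z] [[[x' y'] f'] z'] e; apply sig_ext; cbn.
  generalize (f_equal (fun p : Spec weilDDvD => p ((0, (1, (0, (0, (0, tt))))) : pow 5)) e);
  generalize (f_equal (fun p : Spec weilDDvD => p ((0, (0, (1, (0, (0, tt))))) : pow 5)) e);
  generalize (f_equal (fun p : Spec weilDDvD => p ((0, (0, (0, (0, (1, tt))))) : pow 5)) e);
  cbn; intros h k l; ring_simplify in h; ring_simplify in k; ring_simplify in l.
  f_equal; [f_equal|]; apply sig_ext; assumption.
Qed.

Definition inf1 : infinitesimal unit := existT _ _ (existT _ _ ev1_bij).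
Definition infD : infinitesimal D := existT _ _ (existT _ _ evD_bij).
Definition infD2 : infinitesimal D2 := existT _ _ (existT _ _ evD2_bij).
Definition infDD : infinitesimal (D * D) := existT _ _ (existT _ _ evDD_bij).
Definition infDDvD : infinitesimal DDvD := existT _ _ (existT _ _ evDDvD_bij).

Inductive corner : Set := Left | Middle | Right.

Definition span_graph : graph :=
  Graph (fun _ : bool => Middle) (fun b => if b then Left else Right).

Lemma finite_corner : finite (vert span_graph).
Proof.
exists [Left; Middle; Right]; split.
- repeat constructor; cbn; intuition discriminate.
- intros []; cbn; tauto.
Qed.

Lemma finite_bool : finite (edge span_graph).
Proof.
exists [true; false]; split.
- repeat constructor; cbn; intuition discriminate.
- intros []; cbn; tauto.
Qed.

Definition span_obj (A B C : Type) (v : corner) : Type :=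
  match v with Left => A | Middle => B | Right => C end.

Definition span (A B C P : Type) (f : B -> A) (g : B -> C) (l : A -> P)
    (r : C -> P) (e : forall b, l (f b) = r (g b)) : cocone span_graph :=
  Cocone span_graph (span_obj A B C)
    (fun b => match b return B -> span_obj A B C (if b then Left else Right)
              with true => f | false => g end)
    (fun v => match v return span_obj A B C v -> P with
              | Left => l | Middle => fun b => l (f b) | Right => r end)
    (fun b => match b with true => fun _ => eq_refl
                         | false => fun x => eq_sym (e x) end).

Section Span.

Variables (A B C P : Type) (f : B -> A) (g : B -> C) (l : A -> P) (r : C -> P).
Variable e : forall b, l (f b) = r (g b).

Definition span_matching X (u : A -> X) (v : C -> X)
    (h : forall b, u (f b) = v (g b)) : matching (span f g l r e) X :=
  Matching (span f g l r e)
    (fun w => match w return span_obj A B C w -> X with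
              | Left => u | Middle => fun b => u (f b) | Right => v end)
    (fun b => match b with true => fun _ => eq_refl
                         | false => fun x => eq_sym (h x) end).

Lemma span_limiting X
  (glue : forall (u : A -> X) (v : C -> X),
    (forall b, u (f b) = v (g b)) -> P -> X)
  (glue_l : forall u v h a, glue u v h (l a) = u a)
  (glue_r : forall u v h c, glue u v h (r c) = v c)
  (uniq : forall k k' : P -> X, (forall a, k (l a) = k' (l a)) ->
    (forall c, k (r c) = k' (r c)) -> k = k') :
  limiting (span f g l r e) X.
Proof.
apply bij_intro with (g := fun s : matching (span f g l r e) X =>
  glue (leg_map s Left) (leg_map s Right) (fun b =>
    eq_trans (leg_map_arr s true b) (eq_sym (leg_map_arr s false b)))).
- intros s; apply matching_ext; intros []; cbn; intros x.
  + apply glue_l.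
  + rewrite glue_l; apply (leg_map_arr s true x).
  + apply glue_r.
- intros k k' h; apply uniq.
  + intros a; apply (f_equal (fun s : matching (span f g l r e) X => leg_map s Left a) h).
  + intros c; apply (f_equal (fun s : matching (span f g l r e) X => leg_map s Right c) h).
Qed.

Definition amalg X (H : limiting (span f g l r e) X) (u : A -> X) (v : C -> X)
    (h : forall b, u (f b) = v (g b)) : P -> X :=
  inv H (span_matching u v h).

Lemma amalg_l X H u v h a : @amalg X H u v h (l a) = u a.
Proof.
exact (f_equal (fun s : matching (span f g l r e) X => leg_map s Left a)
  (inv_r H (span_matching u v h))).
Qed.

Lemma amalg_r X H u v h c : @amalg X H u v h (r c) = v c.
Proof.
exact (f_equal (fun s : matching (span f g l r e) X => leg_map s Right c)
  (inv_r H (span_matching u v h))).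
Qed.

Lemma amalg_uniq X (H : limiting (span f g l r e) X) (k k' : P -> X) :
  (forall a, k (l a) = k' (l a)) -> (forall c, k (r c) = k' (r c)) -> k = k'.
Proof.
intros hl hr; apply (bij_inj H), matching_ext; intros []; cbn; trivial.
Qed.

End Span.

Lemma D2_axes (u : unit) : D2_l ((fun _ => D0) u) = D2_r ((fun _ => D0) u).
Proof. apply sig_ext; reflexivity. Qed.

(** [D <- 1 -> D] under [D2], through the axes. *)
Definition D2_cocone : cocone span_graph :=
  span (fun _ : unit => D0) (fun _ => D0) D2_l D2_r D2_axes.

Lemma DDvD_legs (p : D2) : DDvD_prod (proj1_sig p) = DDvD_base (proj1_sig p).
Proof.
destruct p as [[d e] h]; apply sig_ext; cbn; f_equal; apply sig_ext; exact h.
Qed.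

(** [D * D <- D2 -> D * D] under [DDvD]: the left leg is
    [(d1, d2) |-> (d1, d2, d1 d2)], the right leg [(d1, d2) |-> (d1, d2, 0)]. *)
Definition DDvD_cocone : cocone span_graph :=
  span (fun p : D2 => proj1_sig p) (fun p => proj1_sig p)
    DDvD_prod DDvD_base DDvD_legs.

Section KL.

Hypothesis KL : KockLawvere.

Lemma kl_coeffs (W : weil) E (o : E -> Spec W) : bijection o ->
  bijection (fun (w : W) (x : E) => o x w).
Proof.
intros ob; apply (bij_intro _ (fun h => inv (KL W) (fun p => h (inv ob p)))).
- intros h; apply functional_extensionality; intros x.
  change ((fun p : Spec W => p (inv (KL W) (fun p => h (inv ob p)))) (o x) = h x).
  transitivity ((fun p : Spec W => h (inv ob p)) (o x)).
  + exact (f_equal (fun k => k (o x)) (inv_r (KL W) (fun p => h (inv ob p)))).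
  + cbn; now rewrite inv_l.
- intros v w h; apply (bij_inj (KL W)), functional_extensionality; intros p.
  rewrite <- (inv_r ob p); exact (f_equal (fun k => k (inv ob p)) h).
Qed.

Definition klD : bijection polD := kl_coeffs evD_bij.
Definition klD2 : bijection polD2 := kl_coeffs evD2_bij.
Definition klDD : bijection polDD := kl_coeffs evDD_bij.
Definition klDDvD : bijection polDDvD := kl_coeffs evDDvD_bij.

Lemma polD2_l w d : polD2 w (D2_l d) = polD (fst w, (fst (snd w), tt)) d.
Proof. pow_cases; cbn; ring. Qed.

Lemma polD2_r w d : polD2 w (D2_r d) = polD (fst w, (fst (snd (snd w)), tt)) d.
Proof. pow_cases; cbn; ring. Qed.

Lemma polD_0 w : polD w D0 = fst w.
Proof. pow_cases; cbn; ring. Qed.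

Lemma polDD_D2 w (p : D2) : polDD w (proj1_sig p) =
  polD2 (fst w, (fst (snd w), (fst (snd (snd w)), tt))) p.
Proof.
destruct p as [[[d hd] [e he]] z]; pow_cases; cbn in z |- *.
rewrite z; ring.
Qed.

Lemma D2_limiting_line : limiting D2_cocone R.
Proof.
apply span_limiting with (glue := fun u v _ =>
  polD2 (fst (inv klD u), (fst (snd (inv klD u)), (fst (snd (inv klD v)), tt)))).
- intros u v h d; rewrite polD2_l.
  transitivity (polD (inv klD u) d); [|now rewrite inv_r].
  now destruct (inv klD u) as [a [b []]].
- intros u v h d; rewrite polD2_r.
  change (polD (fst (inv klD u), (fst (snd (inv klD v)), tt)) d = v d).
  assert (fst (inv klD u) = fst (inv klD v)) as e.
  { rewrite <- 2!polD_0, 2!(inv_r klD); exact (h tt). }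
  transitivity (polD (inv klD v) d); [|now rewrite inv_r].
  rewrite e; now destruct (inv klD v) as [a [b []]].
- intros k k'; rewrite <- (inv_r klD2 k), <- (inv_r klD2 k').
  destruct (inv klD2 k) as [a [b [c []]]], (inv klD2 k') as [a' [b' [c' []]]].
  intros hl hr.
  assert (polD (a, (b, tt)) = polD (a', (b', tt))) as hb.
  { apply functional_extensionality; intros d; generalize (hl d).
    now rewrite 2!polD2_l. }
  assert (polD (a, (c, tt)) = polD (a', (c', tt))) as hc.
  { apply functional_extensionality; intros d; generalize (hr d).
    now rewrite 2!polD2_r. }
  apply (bij_inj klD) in hb, hc; congruence.
Qed.

Lemma polDDvD_base w p : polDDvD w (DDvD_base p) =
  polDD (fst w, (fst (snd w), (fst (snd (snd w)), (fst (snd (snd (snd w))), tt)))) p.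
Proof. destruct p as [[d hd] [e he]]; pow_cases; cbn; ring. Qed.

Lemma polDDvD_prod w p : polDDvD w (DDvD_prod p) =
  polDD (fst w, (fst (snd w), (fst (snd (snd w)),
    (fst (snd (snd (snd w))) + fst (snd (snd (snd (snd w)))), tt)))) p.
Proof. destruct p as [[d hd] [e he]]; pow_cases; cbn; ring. Qed.

Lemma DDvD_limiting_line : limiting DDvD_cocone R.
Proof.
apply span_limiting with (glue := fun u v _ =>
  let (a, s) := inv klDD v in let (b, s) := s in let (c, s) := s in
  let (m, _) := s in
  polDDvD (a, (b, (c, (m, (fst (snd (snd (snd (inv klDD u)))) + - m, tt)))))).
- intros u v; rewrite <- (inv_r klDD u), <- (inv_r klDD v), 2!(inv_l klDD).
  destruct (inv klDD u) as [a [b [c [m []]]]],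
    (inv klDD v) as [a' [b' [c' [m' []]]]]; intros h p.
  assert (polD2 (a, (b, (c, tt))) = polD2 (a', (b', (c', tt)))) as e.
  { apply functional_extensionality; intros q; generalize (h q).
    now rewrite 2!polDD_D2. }
  apply (bij_inj klD2) in e; injection e as <- <- <-.
  rewrite polDDvD_prod; f_equal; by_coord.
- intros u v; rewrite <- (inv_r klDD v), (inv_l klDD).
  destruct (inv klDD v) as [a' [b' [c' [m' []]]]]; intros h p.
  rewrite polDDvD_base; reflexivity.
- intros k k'; rewrite <- (inv_r klDDvD k), <- (inv_r klDDvD k').
  destruct (inv klDDvD k) as [a [b [c [m [n []]]]]],
    (inv klDDvD k') as [a' [b' [c' [m' [n' []]]]]]; intros hl hr.
  assert (polDD (a, (b, (c, (m + n, tt)))) = polDD (a', (b', (c', (m' + n', tt))))) as hb.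
  { apply functional_extensionality; intros d; generalize (hl d).
    now rewrite 2!polDDvD_prod. }
  assert (polDD (a, (b, (c, (m, tt)))) = polDD (a', (b', (c', (m', tt))))) as hc.
  { apply functional_extensionality; intros d; generalize (hr d).
    now rewrite 2!polDDvD_base. }
  apply (bij_inj klDD) in hb, hc; injection hc as <- <- <- <-.
  injection hb as h; do 4 f_equal; f_equal; f_equal.
  transitivity ((m + n) + - m); [ring | rewrite h; ring].
Qed.

Lemma D2_limiting X (mX : microlinear X) : limiting D2_cocone X.
Proof.
apply (microlinear_limiting mX finite_corner finite_bool).
- intros []; [exact infD | exact inf1 | exact infD].
- exact infD2.
- exact D2_limiting_line.
Qed.

Lemma DDvD_limiting X (mX : microlinear X) : limiting DDvD_cocone X.
Proof.
apply (microlinear_limiting mX finite_corner finite_bool).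
- intros []; [exact infDD | exact infD2 | exact infDD].
- exact infDDvD.
- exact DDvD_limiting_line.
Qed.

Record tangent (X : Type) (x : X) : Type := Tangent {
  tan :> D -> X;
  tan_0 : tan D0 = x }.

Definition tangent_zero (X : Type) (x : X) : tangent x :=
  Tangent (fun _ => x) eq_refl.

Section Micro.

Variables (X : Type) (mX : microlinear X).

Definition tangent_amalg (x : X) (t1 t2 : tangent x) : D2 -> X :=
  amalg (D2_limiting mX) t1 t2
    (fun _ => eq_trans (tan_0 t1) (eq_sym (tan_0 t2))).

Lemma tangent_amalg_0 (x : X) (t1 t2 : tangent x) :
  tangent_amalg t1 t2 (D2_diag D0) = x.
Proof.
rewrite <- (tan_0 t1); unfold tangent_amalg.
replace (D2_diag D0) with (D2_l D0) by (apply sig_ext; reflexivity).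
apply amalg_l.
Qed.

Definition tangent_add (x : X) (t1 t2 : tangent x) : tangent x :=
  Tangent (fun d => tangent_amalg t1 t2 (D2_diag d)) (tangent_amalg_0 t1 t2).

(** In view of the legs of [DDvD_cocone], the amalgam [k] satisfies
    [k (d1, d2, d1 d2) = g1 (d1, d2)] and [k (d1, d2, 0) = g2 (d1, d2)]. *)
Definition strong_diff (g1 g2 : D * D -> X)
    (h : forall p : D2, g1 (proj1_sig p) = g2 (proj1_sig p)) : D -> X :=
  fun e => amalg (DDvD_limiting mX) g1 g2 h (DDvD_top e).

Lemma strong_diff_0 g1 g2 h : @strong_diff g1 g2 h D0 = g2 (D0, D0).
Proof.
unfold strong_diff.
replace (DDvD_top D0) with (DDvD_base (D0, D0)) by (apply sig_ext; reflexivity).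
apply amalg_r.
Qed.

End Micro.

Definition Fun (A : Type) : Type := (A -> R) -> R.

Lemma microlinear_Fun (A : Type) : microlinear (Fun A).
Proof. apply microlinear_exp, microlinear_line. Qed.

Definition dirac (A : Type) (a : A) : Fun A := fun f => f a.

Definition conv (A B : Type) (f : Fun A) (g : Fun B) : Fun (A * B) :=
  fun h => f (fun a => g (fun b => h (a, b))).

Definition conv_tilde (A B : Type) (f : Fun A) (g : Fun B) : Fun (A * B) :=
  fun h => g (fun b => f (fun a => h (a, b))).

Definition distribution (M : Type) (u : Fun M) : Prop :=
  forall (r : R) (f : M -> R), u (fun x => r * f x) = r * u f.

Record dirac_flow (M : Type) (x : M) : Type := DiracFlow {
  flow :> tangent (dirac x);
  flow_distribution : forall d, distribution (flow d) }.

Definition oconv A B (xi1 : D -> Fun A) (xi2 : D -> Fun B) (p : D * D) :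
  Fun (A * B) := conv (xi1 (fst p)) (xi2 (snd p)).

Definition oconv_tilde A B (xi1 : D -> Fun A) (xi2 : D -> Fun B) (p : D * D) :
  Fun (A * B) := conv_tilde (xi1 (fst p)) (xi2 (snd p)).

Lemma oconv_D2 A B (a : A) (b : B) (xi1 : tangent (dirac a))
    (xi2 : tangent (dirac b)) (p : D2) :
  oconv_tilde xi1 xi2 (proj1_sig p) = oconv xi1 xi2 (proj1_sig p).
Proof.
revert p; apply equal_f.
apply (amalg_uniq (D2_limiting (@microlinear_Fun (A * B)))); intros d;
  unfold oconv_tilde, oconv; cbn.
- now rewrite (tan_0 xi2).
- now rewrite (tan_0 xi1).
Qed.

Lemma bracket_0 A B (a : A) (b : B) (xi1 : tangent (dirac a))
    (xi2 : tangent (dirac b)) :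
  strong_diff (@microlinear_Fun (A * B)) (oconv_tilde xi1 xi2) (oconv xi1 xi2)
    (oconv_D2 xi1 xi2) D0 = dirac (a, b).
Proof.
rewrite strong_diff_0; unfold oconv; cbn; now rewrite (tan_0 xi1), (tan_0 xi2).
Qed.

Definition bracket A B (a : A) (b : B) (xi1 : tangent (dirac a))
    (xi2 : tangent (dirac b)) : tangent (dirac (a, b)) :=
  Tangent (strong_diff (@microlinear_Fun (A * B))
    (oconv_tilde xi1 xi2) (oconv xi1 xi2) (oconv_D2 xi1 xi2))
    (bracket_0 xi1 xi2).

End KL.

Definition push (A B : Type) (s : A -> B) (phi : Fun A) : Fun B :=
  fun h => phi (fun x => h (s x)).

Definition push_tangent (A B : Type) (s : A -> B) (a : A)
    (t : tangent (dirac a)) : tangent (dirac (s a)) :=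
  Tangent (fun d => push s (t d)) (f_equal (push s) (tan_0 t)).

(** Triple products are bracketed to the right; [push] along these maps is the
    identification of functionals on cyclically permuted triple products. *)
Definition rot1 (A B C : Type) (p : B * (C * A)) : A * (B * C) :=
  let '(b, (c, a)) := p in (a, (b, c)).

Definition rot2 (A B C : Type) (p : C * (A * B)) : A * (B * C) :=
  let '(c, (a, b)) := p in (a, (b, c)).

End Line.

(* Main.v *)
(** By the Kock-Lawvere axiom a tangent vector at [dirac a] has the form
    [d |-> dirac a + d V].  For a Dirac flow [V] is homogeneous, hence linear,
    so that [xi1 (d1) * xi2 (d2)] can be expanded as a polynomial in [d1], [d2]
    whose [d1 d2]-coefficient is [V1 V2].  The bracket therefore has the
    velocity [V2 V1 - V1 V2], the velocity of a sum is the sum of the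
    velocities, and the identity becomes the Jacobi identity for commutators
    of linear operators acting in different variables. *)

From Stdlib Require Import Ring FunctionalExtensionality ProofIrrelevance.
Require Import Defs.

Section Velocities.

Context {R : comRing}.

Add Ring line_ring : (comRing_theory R).

Local Open Scope line_scope.

Record linear {A : Type} (V : Fun R A) : Prop := Linear {
  linear_add : forall f g, V (fun x => f x + g x) = V f + V g;
  linear_scale : distribution V }.

Arguments linear_add {A V}.
Arguments linear_scale {A V}.

Lemma linear_sub {A} {V : Fun R A} (hV : linear V) (f g : A -> R) :
  V (fun x => f x + - g x) = V f + - V g.
Proof.
replace (fun x => f x + - g x) with (fun x => f x + opp R 1 * g x)
  by (apply functional_extensionality; intros x; ring).
rewrite (linear_add hV f (fun x => opp R 1 * g x)), (linear_scale hV); ring.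
Qed.

Lemma linear_conv {A B} {V : Fun R A} {W : Fun R B} :
  linear V -> linear W -> linear (conv V W).
Proof.
intros hV hW; split; [intros f g | intros r f]; unfold conv.
- rewrite <- (linear_add hV); f_equal; apply functional_extensionality;
    intros a; apply (linear_add hW).
- rewrite <- (linear_scale hV); f_equal; apply functional_extensionality;
    intros a; apply (linear_scale hW).
Qed.

Lemma linear_conv_tilde {A B} {V : Fun R A} {W : Fun R B} :
  linear V -> linear W -> linear (conv_tilde V W).
Proof.
intros hV hW; split; [intros f g | intros r f]; unfold conv_tilde.
- rewrite <- (linear_add hW); f_equal; apply functional_extensionality;
    intros b; apply (linear_add hV).
- rewrite <- (linear_scale hW); f_equal; apply functional_extensionality;
    intros b; apply (linear_scale hV).
Qed.

(** As operators in separate variables this is [W] after [V] minus [V] after [W], the sign that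
    [bracket] produces. *)
Definition commutator {A B} (V : Fun R A) (W : Fun R B) : Fun R (A * B) :=
  fun h => conv_tilde V W h + - conv V W h.

Lemma linear_commutator {A B} {V : Fun R A} {W : Fun R B} :
  linear V -> linear W -> linear (commutator V W).
Proof.
intros hV hW; pose proof (linear_conv hV hW) as h1;
  pose proof (linear_conv_tilde hV hW) as h2.
split; [intros f g | intros r f]; unfold commutator.
- rewrite (linear_add h1), (linear_add h2); ring.
- rewrite (linear_scale h1), (linear_scale h2); ring.
Qed.

(** A relation rather than a chosen functional, so that each construction on tangents can be given
    an explicit formula. *)
Definition velocity {A} {a : A} (t : tangent R (dirac R a)) (V : Fun R A) : Prop :=
  forall d f, t d f = f a + proj1_sig d * V f.

Context (KL : KockLawvere R).

(** A single nilpotent [d] cannot be cancelled; for all [d] at once, the Kock-Lawvere axiom makes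
    the slope of a function on [D] unique. *)
Lemma D_cancel (x y : R) :
  (forall d : D R, proj1_sig d * x = proj1_sig d * y) -> x = y.
Proof.
intros h.
assert (polD (R := R) (0, (x, tt)) = polD (0, (y, tt))) as e.
{ apply functional_extensionality; intros d; cbn.
  transitivity (proj1_sig d * x); [ring | rewrite h; ring]. }
apply (bij_inj (klD KL)) in e; congruence.
Qed.

Lemma velocity_exists {A} {a : A} (t : tangent R (dirac R a)) :
  exists V, velocity t V.
Proof.
exists (fun f => fst (snd (inv (klD KL) (fun d => t d f)))); intros d f.
pose proof (equal_f (inv_r (klD KL) (fun d => t d f))) as e.
destruct (inv (klD KL) (fun d => t d f)) as [x [y []]]; cbn in e |- *.
(* Evaluation at [D0] identifies the constant term. *)
assert (x = f a) as <-.
{ transitivity (x + y * 0); [ring|].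
  transitivity (t (D0 R) f); [exact (e (D0 R)) | now rewrite (tan_0 t)]. }
rewrite <- e; ring.
Qed.

(* On [D2] the map [(d, e) |-> V (d f + e g)] is affine, with coefficients
   determined on the axes; evaluate it on the diagonal. *)
Lemma distribution_linear {A} {V : Fun R A} : distribution V -> linear V.
Proof.
intros hV; split; [intros f g | exact hV].
pose (u (p : D2 R) := V (fun x => proj1_sig (fst (proj1_sig p)) * f x
                         + proj1_sig (snd (proj1_sig p)) * g x)).
assert (forall p, u p = proj1_sig (fst (proj1_sig p)) * V f
                      + proj1_sig (snd (proj1_sig p)) * V g) as e.
{ apply equal_f, (amalg_uniq (D2_limiting KL (@microlinear_line R)));
    intros d; unfold u; cbn.
  - transitivity (V (fun x => proj1_sig d * f x)).
    + f_equal; apply functional_extensionality; intros x; ring.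
    + rewrite hV; ring.
  - transitivity (V (fun x => proj1_sig d * g x)).
    + f_equal; apply functional_extensionality; intros x; ring.
    + rewrite hV; ring. }
apply D_cancel; intros d.
transitivity (u (D2_diag d)); [|rewrite e; cbn; ring].
rewrite <- hV; unfold u; cbn; f_equal.
apply functional_extensionality; intros x; ring.
Qed.

(** Both [xi d] and [dirac R a] are homogeneous, hence so is [d] times [V], and [d] cancels. *)
Lemma dirac_flow_velocity {A} {a : A} (xi : dirac_flow R a) :
  exists V, velocity xi V /\ linear V.
Proof.
destruct (velocity_exists xi) as [V hV]; exists V; split; [exact hV|].
apply distribution_linear; intros r f; apply D_cancel; intros d.
pose proof (flow_distribution xi d r f) as e; rewrite 2!hV in e.
transitivity (- (r * f a) + (r * f a + proj1_sig d * V (fun x => r * f x)));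
  [ring | rewrite e; ring].
Qed.

(** The map [g2 + e V] on [DDvD] restricts to [g1] where [e] is [d1 d2] and to [g2] where [e] is
    zero, so by uniqueness it is the amalgam. *)
Lemma strong_diff_eq {A} (g1 g2 : D R * D R -> Fun R A) h (V : Fun R A) :
  (forall p f, g1 p f =
    g2 p f + proj1_sig (fst p) * proj1_sig (snd p) * V f) ->
  forall e f, strong_diff KL (@microlinear_Fun R A) g1 g2 h e f =
    g2 (D0 R, D0 R) f + proj1_sig e * V f.
Proof.
intros hg e f; unfold strong_diff.
set (H := DDvD_limiting KL _).
assert (amalg H g1 g2 h = fun q f =>
  g2 (fst (proj1_sig q)) f + proj1_sig (snd (proj1_sig q)) * V f) as ->;
  [|reflexivity].
apply (amalg_uniq H); intros p; apply functional_extensionality; intros k.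
- rewrite amalg_l, hg; reflexivity.
- rewrite amalg_r; cbn; ring.
Qed.

Lemma velocity_bracket {A B} {a : A} {b : B} {xi1 : tangent R (dirac R a)}
    {xi2 : tangent R (dirac R b)} {V W} :
  velocity xi1 V -> velocity xi2 W -> linear V -> linear W ->
  velocity (bracket KL xi1 xi2) (commutator V W).
Proof.
intros h1 h2 hV hW d h; unfold bracket; cbn.
rewrite (strong_diff_eq _ _ _ (commutator V W)).
- unfold oconv, conv; cbn; now rewrite (tan_0 xi1), (tan_0 xi2).
- intros [d1 d2] f; unfold oconv_tilde, oconv, commutator, conv_tilde, conv.
  cbn [fst snd].
  rewrite h1, h2, h1, h2.
  (* The flow values still inside [V] and [W] stand under binders, so the whole integrands are
     replaced. *)
  replace (fun a => xi2 d2 (fun b => f (a, b))) with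
    (fun x => f (x, b) + proj1_sig d2 * W (fun y => f (x, y)))
    by (apply functional_extensionality; intros x; symmetry; apply h2).
  replace (fun b => xi1 d1 (fun a => f (a, b))) with
    (fun y => f (a, y) + proj1_sig d1 * V (fun x => f (x, y)))
    by (apply functional_extensionality; intros y; symmetry; apply h1).
  (* After splitting by linearity, the two convolutions differ only in the coefficient of
     [d1 d2]. *)
  rewrite (linear_add hV (fun x => f (x, b))
      (fun x => proj1_sig d2 * W (fun y => f (x, y)))), (linear_scale hV).
  rewrite (linear_add hW (fun y => f (a, y))
      (fun y => proj1_sig d1 * V (fun x => f (x, y)))), (linear_scale hW).
  ring.
Qed.

(** The inner bracket is given only as a tangent vector; the linearity of its velocity comes from
    [linear_commutator]. *)
Lemma velocity_bracket2 {A B C} {a : A} {b : B} {c : C}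
    {xi1 : tangent R (dirac R a)} {xi2 : tangent R (dirac R b)}
    {xi3 : tangent R (dirac R c)} {U V W} :
  velocity xi1 U -> velocity xi2 V -> velocity xi3 W ->
  linear U -> linear V -> linear W ->
  velocity (bracket KL xi1 (bracket KL xi2 xi3)) (commutator U (commutator V W)).
Proof.
intros; apply velocity_bracket; auto using velocity_bracket, linear_commutator.
Qed.

Lemma velocity_push {A B} (s : A -> B) {a : A} {t : tangent R (dirac R a)} {V} :
  velocity t V -> velocity (push_tangent s t) (push s V).
Proof. intros h d f; apply h. Qed.

(** The affine map on [D2] with slopes [V1] and [V2] agrees with [t1] and [t2] on the axes, so it is
    the amalgam; the diagonal adds the slopes. *)
Lemma velocity_add {A} {a : A} {t1 t2 : tangent R (dirac R a)} {V1 V2} :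
  velocity t1 V1 -> velocity t2 V2 ->
  velocity (tangent_add KL (@microlinear_Fun R A) t1 t2) (fun f => V1 f + V2 f).
Proof.
intros h1 h2 d f; cbn; unfold tangent_amalg.
set (H := D2_limiting KL _).
set (e := fun _ => eq_trans _ _).
assert (amalg H t1 t2 e = fun p f => f a
  + (proj1_sig (fst (proj1_sig p)) * V1 f
     + proj1_sig (snd (proj1_sig p)) * V2 f)) as ->; [|cbn; ring].
apply (amalg_uniq H); intros p; apply functional_extensionality; intros k.
- rewrite amalg_l, h1; cbn; ring.
- rewrite amalg_r, h2; cbn; ring.
Qed.

Lemma velocity_0 {A} {a : A} {t : tangent R (dirac R a)} {V} :
  velocity t V -> (forall f, V f = 0) -> t = tangent_zero R (dirac R a).
Proof.
intros h hV.
assert (tan t = fun _ => dirac R a) as e.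
{ apply functional_extensionality; intros d.
  apply functional_extensionality; intros f.
  rewrite h, hV; unfold dirac; ring. }
destruct t as [t t0]; cbn in e; subst t.
unfold tangent_zero; f_equal; apply proof_irrelevance.
Qed.

(** Linearity moves the inner differences out of the outer functionals. Of the twelve resulting
    terms, each of the six orders of [U], [V], [W] occurs twice, with opposite signs. *)
Lemma commutator_jacobi {A B C} {U : Fun R A} {V : Fun R B} {W : Fun R C}
    (hU : linear U) (hV : linear V) (hW : linear W) (h : A * (B * C) -> R) :
  commutator U (commutator V W) h
  + push (@rot1 A B C) (commutator V (commutator W U)) h
  + push (@rot2 A B C) (commutator W (commutator U V)) h = 0.
Proof.
unfold push, commutator, conv, conv_tilde, rot1, rot2.
rewrite !(linear_sub hU), !(linear_sub hV), !(linear_sub hW); ring.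
Qed.

End Velocities.

Theorem theorem23 (R : comRing) (KL : KockLawvere R)
  (M1 M2 M3 : Type)
  (m1 : microlinear R M1) (m2 : microlinear R M2) (m3 : microlinear R M3)
  (x1 : M1) (x2 : M2) (x3 : M3)
  (xi1 : dirac_flow R x1) (xi2 : dirac_flow R x2) (xi3 : dirac_flow R x3) :
  let delta := dirac R (x1, (x2, x3)) in
  let add := @tangent_add R KL (Fun R (M1 * (M2 * M3)))
               (@microlinear_Fun R (M1 * (M2 * M3))) delta in
  add (add (bracket KL xi1 (bracket KL xi2 xi3))
           (push_tangent (@rot1 M1 M2 M3) (bracket KL xi2 (bracket KL xi3 xi1))))
      (push_tangent (@rot2 M1 M2 M3) (bracket KL xi3 (bracket KL xi1 xi2)))
  = tangent_zero R delta.
Proof.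
intros delta add.
destruct (dirac_flow_velocity KL xi1) as [U [hU lU]].
destruct (dirac_flow_velocity KL xi2) as [V [hV lV]].
destruct (dirac_flow_velocity KL xi3) as [W [hW lW]].
(* The Jacobi identity instantiates the still unknown velocity as the sum of the three double
   commutators. *)
eapply velocity_0; [|exact (commutator_jacobi lU lV lW)].
apply (velocity_add KL); [apply (velocity_add KL)|].
- exact (velocity_bracket2 KL hU hV hW lU lV lW).
- exact (velocity_push (@rot1 M1 M2 M3) (velocity_bracket2 KL hV hW hU lV lW lU)).
- exact (velocity_push (@rot2 M1 M2 M3) (velocity_bracket2 KL hW hU hV lW lU lV)).
Qed.
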